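(* Let $\lambda$ be a totally real algebraic integer with $[\mathbb{Q}(\lambda^2):\mathbb{Q}]=3$, and let $F(x)\in\mathbb{Z}[x]$ be the minimal polynomial of $\lambda^2$. Then $\lambda\in\mathcal{A}_2$ if and only if there is an interlacing set for $\lambda^2$ and $F(x)$ has a root modulo $2$.
   Context: An algebraic integer is totally real if all roots of its minimal polynomial over $\mathbb{Q}$ are real. The eigenvalues of a graph are those of its adjacency matrix. A rooted tree has height $h$ if the maximum distance from the root to a vertex is $h$. The arboreal height of a totally real algebraic integer $\lambda$ is the least $h$ such that some rooted tree of height $h$ has $\lambda$ as an eigenvalue; $\mathcal{A}_h$ is the set of totally real algebraic integers of arboreal height exactly $h$. For $\lambda$ totally real with $\lambda^2\notin\mathbb{Z}$, let $n=[\mathbb{Q}(\lambda^2):\mathbb{Q}]$, $F$ the minimal polynomial of $\lambda^2$, and $0<\lambda_1<\cdots<\lambda_n$ the positive real roots of $F(x^2)$. A set of nonnegative integers $k_1<\cdots<k_n$ is a left-interlacing set for $\lambda^2$ if $0\le k_1<\lambda_1^2<k_2<\lambda_2^2<\cdots<\lambda_{n-1}^2<k_n<\lambda_n^2$, and a right-interlacing set for $\lambda^2$ if $\lambda_1^2<k_1<\lambda_2^2<k_2<\cdots<k_{n-1}<\lambda_n^2<k_n$. An interlacing set is a left- or right-interlacing set. *)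

(* Defs.v *)
(* MathComp world. *)
From HB Require Import structures.
From mathcomp Require Import all_boot all_order all_fingroup all_algebra all_field.

Set Implicit Arguments.
Unset Strict Implicit.
Unset Printing Implicit Defensive.

Import Order.TTheory GRing.Theory Num.Theory.
Local Open Scope ring_scope.

Definition totally_real_algint (lambda : algC) : Prop :=
  lambda \in Aint /\
  forall z : algC, root (minCpoly lambda) z -> z \is Num.real.

(* [Q(alpha) : Q] = d.  Since algC has infinite dimension over rat, Q(alpha) is
   taken inside a number field L embedded in algC; the dimension does not depend
   on the choice of L and iota. *)
Definition degreeQ (alpha : algC) (d : nat) : Prop :=
  exists (L : fieldExtType rat) (iota : {rmorphism L -> algC}) (x : L),
    iota x = alpha /\ \dim <<1; x>>%VS = d.

Section Graphs.
Variables (T : finType) (e : rel T).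

Definition simple_graph : Prop := symmetric e /\ irreflexive e.

Definition connected_graph : Prop := forall x y : T, connect e x y.

(* For a symmetric e, an edge x -- y is itself the ucycle [:: x; y]; genuine
   cycles are those with at least three vertices. *)
Definition acyclic_graph : Prop :=
  forall c : seq T, ucycle e c -> (size c <= 2)%N.

Definition is_tree : Prop :=
  [/\ simple_graph, connected_graph & acyclic_graph].

(* The least number of edges of a path from x to y; a shortest path has fewer
   than #|T| edges, and the value is #|T| if y is not reachable from x. *)
Definition gdist (x y : T) : nat :=
  find (fun k => [exists p : k.-tuple T, path e x p && (last x p == y)])
       (iota 0 #|T|).

Definition height (r : T) : nat := \max_(v : T) gdist r v.

Definition adjmx : 'M[algC]_#|T| :=
  \matrix_(i, j) (e (enum_val i) (enum_val j))%:R.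

End Graphs.

Definition tree_eigenvalue (h : nat) (lambda : algC) : Prop :=
  exists (T : finType) (e : rel T) (r : T),
    [/\ is_tree e, height e r = h & eigenvalue (adjmx e) lambda].

Definition has_arboreal_height (lambda : algC) (h : nat) : Prop :=
  tree_eigenvalue h lambda /\
  forall h' : nat, tree_eigenvalue h' lambda -> (h <= h')%N.

(* The set A_h. *)
Definition arboreal (h : nat) (lambda : algC) : Prop :=
  totally_real_algint lambda /\ has_arboreal_height lambda h.

(* The positive real roots of F(x^2) in increasing order, F being the minimal
   polynomial of alpha.  In the partial order of algC, 0 < z entails that z is
   real. *)
Definition pos_roots (alpha : algC) (n : nat) (l : n.-tuple algC) : Prop :=
  sorted <%R l /\
  forall z : algC, z \in l <-> 0 < z /\ root (minCpoly alpha \Po 'X^2) z.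

Section Interlacing.
Variables (n : nat) (l : n.-tuple algC) (k : n.-tuple nat).

Definition left_interlacing : Prop :=
  [/\ sorted ltn k,
      forall i : 'I_n, (tnth k i)%:R < tnth l i ^+ 2
    & forall i j : 'I_n, j = i.+1 :> nat -> tnth l i ^+ 2 < (tnth k j)%:R].

Definition right_interlacing : Prop :=
  [/\ sorted ltn k,
      forall i : 'I_n, tnth l i ^+ 2 < (tnth k i)%:R
    & forall i j : 'I_n, j = i.+1 :> nat -> (tnth k i)%:R < tnth l j ^+ 2].

End Interlacing.

(* The set is given by its increasing enumeration k.  Its size n is the number
   of positive roots of F(x^2), which is [Q(alpha) : Q] when alpha is a nonzero
   square of a totally real number. *)
Definition interlacing_set (alpha : algC) (n : nat) (k : n.-tuple nat) : Prop :=
  exists2 l : n.-tuple algC, pos_roots alpha l &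
    left_interlacing l k \/ right_interlacing l k.

(* Main.v *)
(* Eliminating the leaves and the children of the root from the eigenvector
   equations, lambda with lambda^2 = a not an integer is an eigenvalue of a tree
   of height at most 2 iff 1 = \sum_i 1 / (a - k_i) for some natural numbers k_i
   (the numbers of leaves below the children of the root).
   For a cubic with minimal polynomial F, F(k) / (a - k) = - q_k(a) with q_k
   quadratic and monic, q_k having second difference 2 in k.  As 1, a, a^2 are
   independent over Q, such a sum fixes the moments of the weights 1 / F(k): it
   then equals 1 at every conjugate of a, so monotonicity puts some k_i between
   consecutive conjugates, and the F(k_i) cannot all be odd because k^2 = k mod 2.
   Conversely, if F(k) is even then so is F(k + 2), and
     1 = F(k + 1) / (a - (k + 1)) - F(k) / 2 / (a - k)
           - F(k + 2) / 2 / (a - (k + 2)),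
   an integral combination of the 1 / (a - j).  Its coefficients can be made
   nonnegative: given naturals in each of the four intervals cut out by the three
   conjugates, the signs of F alternate and the divided difference of order 3
   gives a relation with positive integral coefficients among the corresponding
   1 / (a - j); every j occurs in such a relation. *)
Require Import Defs.
From HB Require Import structures.
From mathcomp Require Import all_boot all_order all_fingroup all_algebra all_field.
From mathcomp Require Import ring zify.

Set Implicit Arguments.
Unset Strict Implicit.
Unset Printing Implicit Defensive.

Import Order.TTheory GRing.Theory Num.Theory.
Local Open Scope ring_scope.

(** * Trees of height at most two *)

Lemma gdist_le_size (T : finType) (e : rel T) (x : T) (p : seq T) :
  path e x p -> (gdist e x (last x p) <= size p)%N.
Proof.
move=> ep; rewrite leqNgt; apply/negP => lt_p.
have := before_find 0%N lt_p; rewrite nth_iota ?add0n; last first.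
  by apply: leq_trans lt_p _; rewrite -[leqRHS](size_iota 0) find_size.
by move/existsP=> []; exists (in_tuple p); rewrite ep eqxx.
Qed.

Lemma gdist_path (T : finType) (e : rel T) (x y : T) : connect e x y ->
  exists p : seq T, [/\ path e x p, last x p = y & size p = gdist e x y].
Proof.
(* A path without repeated vertices has fewer than [#|T|] edges, so the search in [gdist] succeeds
   and its default value is not reached. *)
case/connectP=> p0 /shortenP[p ep Up _ ->].
have lt_p : (size p < #|T|)%N.
  by rewrite -[(_ < _)%N]/(size (x :: p) <= _)%N -(card_uniqP Up) max_card.
set y' := last x p.
have h : has (fun k => [exists q : k.-tuple T, path e x q && (last x q == y')])
  (iota 0 #|T|).
  apply/hasP; exists (size p); first by rewrite mem_iota.
  by apply/existsP; exists (in_tuple p); rewrite ep eqxx.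
have := nth_find 0%N h; rewrite -/(gdist e x y') nth_iota ?add0n.
  case/existsP=> q /andP[eq /eqP lq]; exists q; split=> //.
  exact: size_tuple.
by rewrite -[X in (_ < X)%N](size_iota 0) -has_find.
Qed.

Lemma height_le2_cases (T : finType) (e : rel T) (r x : T) :
    connected_graph e -> (height e r <= 2)%N ->
  [\/ x = r, e r x | exists2 c, e r c & e c x].
Proof.
move=> conn h2; have [p [ep <- sz_p]] := gdist_path (conn r x).
have : (size p <= 2)%N.
  by rewrite sz_p; apply: leq_trans h2; apply: leq_bigmax.
case: p ep {sz_p} => [|c [|d [|? ?]]] //=; first by constructor 1.
  by case/andP=> rc _ _; constructor 2.
by case/and3P=> rc cd _ _; constructor 3; exists c.
Qed.

Lemma height_le1_cases (T : finType) (e : rel T) (r x : T) :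
  connected_graph e -> (height e r <= 1)%N -> x = r \/ e r x.
Proof.
move=> conn h1; have [p [ep <- sz_p]] := gdist_path (conn r x).
have : (size p <= 1)%N.
  by rewrite sz_p; apply: leq_trans h1; apply: leq_bigmax.
case: p ep {sz_p} => [|c [|? ?]] //=; first by left.
by case/andP=> rc _ _; right.
Qed.

(** Trades vectors indexed by [enum_rank] for functions on the vertices; [eigenvalue] is about row
    vectors, hence the orientation [e y x]. *)
Lemma adjmx_eigenvalueP (T : finType) (e : rel T) (a : algC) :
  reflect (exists2 f : T -> algC,
             forall x, \sum_(y | e y x) f y = a * f x & exists x, f x != 0)
          (eigenvalue (adjmx e) a).
Proof.
apply: (iffP eigenvalueP) => [[v vA v0]|[f fA [x fx]]].
  exists (fun x => v 0 (enum_rank x)) => [x|].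
    move/rowP/(_ (enum_rank x)): vA; rewrite !mxE => <-.
    rewrite [RHS](reindex_onto enum_rank enum_val); last by move=> i _; rewrite enum_valK.
    rewrite [LHS]big_mkcond /=; apply: eq_big => [y|y _].
      by rewrite enum_rankK eqxx.
    by rewrite mxE !enum_rankK; case: ifP => _; rewrite ?mulr1 ?mulr0.
  have [i vi] : exists i, v 0 i != 0.
    apply/existsP; apply: contraR v0; rewrite negb_exists => /forallP v0.
    by apply/eqP/rowP => i; rewrite mxE; apply/eqP; move: (v0 i); rewrite negbK.
  by exists (enum_val i) => /=; rewrite enum_valK.
exists (\row_i f (enum_val i)); last first.
  apply: contraNneq fx => /rowP/(_ (enum_rank x)).
  by rewrite !mxE enum_rankK => ->.
apply/rowP=> j; rewrite !mxE -fA [RHS]big_mkcond /=.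
rewrite [RHS](reindex_onto enum_val enum_rank); last by move=> i _; rewrite enum_rankK.
apply: eq_big => [i|i _]; first by rewrite enum_valK eqxx.
by rewrite !mxE; case: (e _ _); rewrite ?mulr1 ?mulr0.
Qed.

(* Another neighbour y of x would close a cycle of length 3, 4 or 5. *)
Lemma second_level_leaf (T : finType) (e : rel T) (r c x y : T) :
    is_tree e -> (height e r <= 2)%N ->
    e r c -> e c x -> x != r -> e x y -> y = c.
Proof.
case=> [[sym irr] conn acyc] h2 rc cx x_r xy; apply/eqP.
have neq (u v : T) : e u v -> (u == v) = false.
  by move=> uv; apply/eqP=> eq_uv; move: uv; rewrite eq_uv irr.
have ncyc s : (2 < size s)%N -> path.cycle e s -> uniq s = false.
  move=> sz_s cs; apply/negP=> Us.
  by have := acyc s; rewrite /ucycle cs Us leqNgt sz_s => /(_ isT).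
apply: contraT => y_c; have x_r' := negPf x_r.
have c_r : (c == r) = false by rewrite eq_sym neq.
have nrx : e r x = false.
  apply/negP=> rx; have := ncyc [:: r; c; x] isT.
  rewrite /= rc cx (sym x r) rx /= !inE (neq _ _ rc) (neq _ _ cx) eq_sym x_r' /=.
  by move/(_ isT).
have y_r : (y == r) = false.
  by apply/eqP=> y_r; move: xy; rewrite y_r sym nrx.
have [/eqP|ry|[d rd dy]] := height_le2_cases y conn h2; first by rewrite y_r.
  have := ncyc [:: r; c; x; y] isT.
  rewrite /= rc cx xy (sym y) ry /= !inE (neq _ _ rc) (neq _ _ cx) (neq _ _ xy).
  rewrite (neq _ _ ry) (eq_sym r x) x_r' (eq_sym c y) (negPf y_c).
  by move/(_ isT).
have nry : e r y = false.
  apply/negP=> ry; have := ncyc [:: r; d; y] isT.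
  rewrite /= rd dy (sym y) ry /= !inE (neq _ _ rd) (neq _ _ ry) (neq _ _ dy).
  by move/(_ isT).
have [d_c|/negPf d_c] := eqVneq d c.
  have := ncyc [:: c; x; y] isT.
  rewrite /= cx xy (sym y) -d_c dy d_c /= !inE (neq _ _ cx) (neq _ _ xy).
  by rewrite eq_sym (negPf y_c); move/(_ isT).
have := ncyc [:: r; c; x; y; d] isT.
rewrite /= rc cx xy (sym y) dy (sym d) rd /= !inE (neq _ _ rc) (neq _ _ cx).
rewrite (neq _ _ xy) (neq _ _ rd) (eq_sym r) x_r' (eq_sym r y) y_r (eq_sym c y).
rewrite (negPf y_c) (eq_sym c d) d_c (eq_sym y d) (neq _ _ dy).
have -> : (x == d) = false by apply/eqP=> x_d; rewrite x_d rd in nrx.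
by move/(_ isT).
Qed.

(** A leaf below c carries f(c) / a, so the equation at c yields f(c) = a f(r) / (a^2 - k(c)); the
    equation at the root, divided by a f(r), is the claim. *)
Lemma height2_eigen_sum (T : finType) (e : rel T) (r : T) (a : algC) :
    is_tree e -> (height e r <= 2)%N -> eigenvalue (adjmx e) a ->
    (forall k : nat, a ^+ 2 != k%:R) ->
  \sum_(c | e r c) (a ^+ 2 - #|[set x | e c x & x != r]|%:R)^-1 = 1.
Proof.
move=> tree_e h2 /adjmx_eigenvalueP[f fA [x0 fx0]] a2.
have [[sym irr] conn _] := tree_e.
have a0 : a != 0.
  by move: (a2 0%N); apply: contraNneq => ->; rewrite expr0n.
have leaf c x : e r c -> e c x -> x != r -> a * f x = f c.
  move=> rc cx xr; rewrite -fA (big_pred1 c) // => y; rewrite sym.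
  apply/idP/eqP => [xy|->]; last by rewrite sym.
  exact: second_level_leaf tree_e h2 rc cx xr xy.
pose k c := #|[set x | e c x & x != r]|.
have child c : e r c -> f c = a * f r * (a ^+ 2 - (k c)%:R)^-1.
  move=> rc; have := fA c; rewrite (bigD1 r) //=.
  rewrite (eq_bigr (fun _ => a^-1 * f c)); last first.
    move=> x /andP[]; rewrite sym => cx xr.
    by rewrite -(leaf c x) // mulrA mulVf ?mul1r.
  rewrite sumr_const -[X in _ *+ X]/(#|_|).
  have -> : #|[pred x | e x c & x != r]| = k c.
    by rewrite /k cardsE; apply: eq_card => x; rewrite !inE sym.
  have d0 : a ^+ 2 - (k c)%:R != 0 by rewrite subr_eq0.
  move=> E; rewrite -[_ *+ k c]mulr_natl in E; apply: (canRL (mulfK d0)).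
  have -> : f r = a * f c - (k c)%:R * (a^-1 * f c) by rewrite -E addrK.
  by field.
(* Otherwise [f] vanishes on the children, then on the leaves, hence everywhere. *)
have fr : f r != 0.
  apply: contraNneq fx0 => fr.
  have fc c : e r c -> f c = 0 by move=> rc; rewrite child // fr mulr0 mul0r.
  have [->|/fc->|[c rc cx]] := height_le2_cases x0 conn h2; rewrite ?fr //.
  have [->|xr] := eqVneq x0 r; first by rewrite fr.
  by apply/eqP/(mulfI a0); rewrite mulr0 (leaf c) ?fc.
have := fA r; rewrite (eq_bigl (e r)); last by move=> x; rewrite sym.
rewrite (eq_bigr _ child) -mulr_sumr => E.
by apply: (mulfI (mulf_neq0 a0 fr)); rewrite mulr1.
Qed.

(** At height at most 1 no child has a leaf, so the sum is d / a^2 with d the degree of the root,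
    and its value 1 makes a^2 a natural number. *)
Lemma height_gt1 (T : finType) (e : rel T) (r : T) (a : algC) :
    is_tree e -> eigenvalue (adjmx e) a -> (forall k : nat, a ^+ 2 != k%:R) ->
  (1 < height e r)%N.
Proof.
move=> tree_e ea a2; rewrite ltnNge; apply/negP=> h1.
have [[sym irr] conn acyc] := tree_e.
have := height2_eigen_sum tree_e (leqW h1) ea a2.
rewrite (eq_bigr (fun _ => (a ^+ 2)^-1)) => [|c rc]; last first.
  rewrite (_ : [set x | _] = set0) ?cards0 ?subr0 //.
  apply/setP=> x; rewrite !inE; apply/negP=> /andP[cx xr].
  have [/eqP|rx] := height_le1_cases x conn h1; first by rewrite (negPf xr).
  have neq (u v : T) : e u v -> (u == v) = false.
    by move=> uv; apply/eqP=> eq_uv; move: uv; rewrite eq_uv irr.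
  have := acyc [:: r; c; x]; rewrite /ucycle /= rc cx (sym x) rx /=.
  by rewrite !inE (neq _ _ rc) (neq _ _ cx) (neq _ _ rx) => /(_ isT).
have a0 : a ^+ 2 != 0 by apply: (a2 0%N).
rewrite sumr_const -mulr_natl => /(congr1 ( *%R^~ (a ^+ 2))) /=.
by rewrite mulfVK // mul1r => /esym/eqP; apply/negP.
Qed.

(** * Trees given by a parent map *)

(** The condition [x != y] discards the loop at a root that is its own parent. *)
Definition parent_rel (T : eqType) (p : T -> T) : rel T :=
  fun x y => (x != y) && ((p x == y) || (p y == x)).

Section ParentTree.
Variables (T : finType) (p : T -> T) (d : T -> nat) (r : T).
Hypotheses (pr : p r = r) (dp : forall x, x != r -> (d (p x) < d x)%N).
Local Notation e := (parent_rel p).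

Lemma parent_rel_sym : symmetric e.
Proof. by move=> x y; rewrite /parent_rel eq_sym orbC. Qed.

Lemma parent_rel_le (x y : T) : e x y -> (d y <= d x)%N -> y = p x.
Proof.
case/andP=> xy /orP[/eqP-> //|/eqP px] le_yx.
have yr : y != r by apply: contraNneq xy => yr; rewrite -px yr pr.
by have := dp yr; rewrite px ltnNge le_yx.
Qed.

Lemma parent_rel_path (x : T) :
  exists q : seq T, [/\ path e r q, last r q = x & (size q <= d x)%N].
Proof.
have [m] := ubnP (d x); elim: m x => // m IHm x ltx.
have [->|xr] := eqVneq x r; first by exists [::].
have [q [eq lq sq]] := IHm (p x) (leq_trans (dp xr) ltx).
exists (rcons q x); split; [|by rewrite last_rcons|].
  rewrite rcons_path eq lq /parent_rel eqxx orbT andbT.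
  by apply: contraTneq (dp xr) => ->; rewrite ltnn.
by rewrite size_rcons; apply: leq_ltn_trans sq (dp xr).
Qed.

Lemma parent_rel_height (h : nat) :
  (forall x, d x <= h)%N -> (height e r <= h)%N.
Proof.
move=> dh; apply/bigmax_leqP => x _.
have [q [eq <- sq]] := parent_rel_path x.
exact: leq_trans (gdist_le_size eq) (leq_trans sq (dh _)).
Qed.

(* Both neighbours on a cycle of a vertex of maximal depth are its parent. *)
Lemma parent_rel_tree : is_tree e.
Proof.
split.
- by split=> [|x]; [apply: parent_rel_sym | rewrite /parent_rel eqxx].
- have conn x : connect e r x.
    by have [q [eq <- _]] := parent_rel_path x; apply/connectP; exists q.
  move=> x y; apply: connect_trans (conn y).
  by rewrite (sym_connect_sym parent_rel_sym).
move=> c uc; rewrite leqNgt; apply/negP=> c_gt2.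
have [x0 x0c] : exists x, x \in c.
  by case: c c_gt2 {uc} => // x c _; exists x; rewrite mem_head.
case: (arg_maxnP d x0c) => x xc xmax.
have [i c' rot_c] := rot_to xc.
move: uc; rewrite -(rot_ucycle i) rot_c => uc.
have c'c z : z \in c' -> (d z <= d x)%N.
  move=> zc'; apply: (xmax z); suff: z \in c by [].
  by rewrite -(mem_rot i) rot_c inE zc' orbT.
move: c_gt2; rewrite -(size_rot i) rot_c ltnS.
case/andP: uc c'c => + /andP[_].
case: c' {rot_c} => [|y c'] //=; case/lastP: c' => [|c' z] //=.
rewrite rcons_path last_rcons => /and3P[xy _ zx] /andP[+ _] le_d _.
have -> : y = p x by apply: parent_rel_le xy _; rewrite le_d ?mem_head.
have -> : z = p x.
  apply: parent_rel_le; first by rewrite parent_rel_sym.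
  by rewrite le_d // inE mem_rcons mem_head orbT.
by rewrite mem_rcons mem_head.
Qed.

(** The strict decrease of [d] towards the root separates the parent of a vertex from its children;
    [y != r] keeps the root from counting as its own child. *)
Lemma sum_parent_rel (V : nmodType) (f : T -> V) (x : T) :
  \sum_(y | e y x) f y =
    (if x == r then 0 else f (p x)) + \sum_(y | (y != r) && (p y == x)) f y.
Proof.
have [->|xr] := eqVneq x r.
  rewrite add0r; apply: eq_bigl => y; rewrite /parent_rel pr.
  by rewrite (eq_sym r y); case: eqP => //= _; rewrite orbF.
have px : p x != x by apply: contraTneq (dp xr) => ->; rewrite ltnn.
rewrite (bigD1 (p x)) /=; last by rewrite /parent_rel px eqxx orbT.
congr (_ + _); apply: eq_bigl => y; rewrite /parent_rel.
have [->|yr] := eqVneq y r.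
  by rewrite pr !(eq_sym r) (negPf xr) /=; case: eqVneq.
have [pyx|/=] := eqVneq (p y) x.
  rewrite orTb andbT; apply/andP; split.
    by apply: contraTneq (dp yr) => yx; rewrite pyx yx ltnn.
  apply: contraTneq (dp yr) => yx; rewrite pyx yx -leqNgt.
  exact: ltnW (dp xr).
by move=> _; rewrite (eq_sym (p x)); case: (eqVneq y (p x)); rewrite ?andbF.
Qed.

End ParentTree.

(** * Spiders: trees of height at most two with prescribed numbers of leaves *)

Lemma big_option (V : nmodType) (I : finType) (f : option I -> V) :
  \sum_o f o = f None + \sum_i f (Some i).
Proof.
rewrite (bigD1 None) //=; congr (_ + _).
rewrite (reindex_omap Some id) => [|[]] //=.
by apply: eq_bigl => i; rewrite eqxx.
Qed.

(* The root is None, its i-th child Some (existT _ i None), and the j-th leaf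
   below that child Some (existT _ i (Some j)). *)
Definition spider (s : seq nat) : finType :=
  option {i : 'I_(size s) & option 'I_(nth 0%N s i)}.

Section Spider.
Variable s : seq nat.

Definition spider_child (i : 'I_(size s)) : spider s :=
  Some (existT (fun i : 'I_(size s) => option 'I_(nth 0%N s i)) i None).

Definition spider_leaf (i : 'I_(size s)) (j : 'I_(nth 0%N s i)) : spider s :=
  Some (existT (fun i : 'I_(size s) => option 'I_(nth 0%N s i)) i (Some j)).

(** The value at a leaf depends only on the child above it, which is enough for the parent map, the
    depth and the eigenvector. *)
Definition spider_rec (A : Type) (a : A) (b : 'I_(size s) -> A) (c : 'I_(size s) -> A)
    (x : spider s) : A :=
  if x is Some u then if tagged u is Some _ then c (tag u) else b (tag u) else a.

Definition spider_parent : spider s -> spider s :=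
  spider_rec None (fun _ => None) spider_child.

Definition spider_depth : spider s -> nat :=
  spider_rec 0%N (fun _ => 1%N) (fun _ => 2).

Lemma big_spider (V : nmodType) (f : spider s -> V) :
  \sum_x f x = f None + \sum_i (f (spider_child i) + \sum_j f (@spider_leaf i j)).
Proof.
rewrite big_option; congr (_ + _).
under [RHS]eq_bigr => i _ do
  rewrite -(big_option (fun o =>
    f (Some (existT (fun i : 'I_(size s) => option 'I_(nth 0%N s i)) i o)))).
by rewrite sig_big_dep /=; apply: eq_bigr => -[].
Qed.

Lemma spider_child_inj : injective spider_child.
Proof. by move=> i j /(congr1 (omap tag)) [->]. Qed.

Lemma spider_depth_parent (x : spider s) :
  x != None -> (spider_depth (spider_parent x) < spider_depth x)%N.
Proof. by case: x => [[i [j|]]|]. Qed.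

(** Reverses the elimination: the eigenvector is 1 at the root, a / (a^2 - k) at a child with k
    leaves and 1 / (a^2 - k) at these leaves. *)
Lemma spider_eigenvalue (a : algC) :
    (forall k : nat, a ^+ 2 != k%:R) ->
    \sum_(k <- s) (a ^+ 2 - k%:R)^-1 = 1 ->
  eigenvalue (adjmx (parent_rel spider_parent)) a.
Proof.
move=> a2 sum1; have a0 : a != 0.
  by move: (a2 0%N); apply: contraNneq => ->; rewrite expr0n.
pose b i := a / (a ^+ 2 - (nth 0%N s i)%:R).
pose f := spider_rec 1 b (fun i => b i / a).
apply/adjmx_eigenvalueP; exists f; last by exists None; apply: oner_neq0.
move=> x; rewrite (@sum_parent_rel _ _ spider_depth None) //; last first.
  exact: spider_depth_parent.
rewrite big_mkcond big_spider /= add0r.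
case: x => [[i [j|]]|] /=.
- rewrite big1 ?addr0 => [|i' _]; first by rewrite mulrCA divff ?mulr1.
  by rewrite add0r big1 // => j' _; case: eqP.
- rewrite (bigD1 i) //= [X in _ + (_ + X)]big1 => [|i' i'i]; last first.
    rewrite add0r big1 // => j _.
    by case: eqP => // /spider_child_inj/eqP; rewrite (negPf i'i).
  rewrite eqxx add0r addr0 sumr_const card_ord -mulr_natl /f /= /b.
  have d0 : a ^+ 2 - (nth 0%N s i)%:R != 0 by rewrite subr_eq0.
  by field; rewrite d0 a0.
(* At the root the eigenvector equation is [sum1] multiplied by [a]. *)
rewrite ?add0r mulr1 -[RHS]mulr1 -sum1 big_distrr /= (big_nth 0%N) big_mkord.
by apply: eq_bigr => i _; rewrite big1 ?addr0.
Qed.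

End Spider.

(** Minimality comes from [height_gt1], which also forces the spider, of height at most 2, to have
    height exactly 2. *)
Lemma tree_eigenvalue2P (a : algC) :
    (forall k : nat, a ^+ 2 != k%:R) ->
  has_arboreal_height a 2 <->
  exists s : seq nat, \sum_(k <- s) (a ^+ 2 - k%:R)^-1 = 1.
Proof.
move=> a2; split=> [[[T [e [r [tree_e h2 ea]]]] _]|[s sum1]].
  exists [seq #|[set x | e c x & x != r]| | c <- enum (e r)].
  by rewrite big_map big_enum; apply: height2_eigen_sum; rewrite ?h2.
have gt1 h : tree_eigenvalue h a -> (1 < h)%N.
  by case=> T [e [r [tree_e <- ea]]]; apply: height_gt1 ea a2.
split=> //; exists (spider s), (parent_rel (@spider_parent s)), None.
have tree_s : is_tree (parent_rel (@spider_parent s)).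
  exact: (@parent_rel_tree _ _ (@spider_depth s) None erefl (@spider_depth_parent s)).
split=> //; last exact: spider_eigenvalue.
apply/eqP; rewrite eqn_leq; apply/andP; split.
  apply: (parent_rel_height (@spider_depth_parent s)).
  by case=> [[i [j|]]|].
exact: height_gt1 tree_s (spider_eigenvalue a2 sum1) a2.
Qed.

(** * Minimal polynomials over the rationals *)

Lemma minCpoly_irreducible (x : algC) :
  exists2 p : {poly rat}, minCpoly x = map_poly ratr p &
    irreducible_poly p /\
    forall q : {poly rat}, root (map_poly ratr q) x = (p %| q).
Proof.
have [p [Ep mon_p] minp] := minCpolyP x; exists p => //; split=> //.
have px : root (map_poly ratr p) x by rewrite minp dvdpp.
apply/(subfx_irreducibleP px); first exact: monic_neq0.
by move=> q; rewrite minp => /dvdp_leq le_pq q0; apply: le_pq.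
Qed.

(** An irreducible rational polynomial is separable: its derivative is nonzero and of smaller
    degree, hence coprime to it. *)
Lemma uniq_roots_minCpoly (x : algC) (r : seq algC) :
  minCpoly x = \prod_(z <- r) ('X - z%:P) -> uniq r.
Proof.
have [p Ep [irr_p _]] := minCpoly_irreducible x.
move=> Er; rewrite -separable_prod_XsubC -Er Ep separable_map separable_poly.unlock.
have p_gt1 : (1 < size p)%N by case: irr_p.
rewrite (irreducible_poly_coprime _ irr_p); apply/negP=> /dvdp_leq.
have p'0 : p^`() != 0.
  apply: contraTneq p_gt1 => /polyP/(_ (size p).-2).
  rewrite coef0 coef_deriv => /eqP; rewrite mulrn_eq0 /= -leqNgt.
  case: (size p) (lead_coefE p) => [|[|n]] //= <-.
  by rewrite lead_coef_eq0 (negPf (irredp_neq0 irr_p)).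
by move/(_ p'0); rewrite leqNgt lt_size_deriv // irredp_neq0.
Qed.

(** The minimal polynomials in [L] and in [algC] both come from rational polynomials, and these
    divide each other. *)
Lemma size_minCpoly_degreeQ (x : algC) (n : nat) :
  degreeQ x n -> size (minCpoly x) = n.+1.
Proof.
case=> L [iota [y [<- <-]]]; rewrite dim_Fadjoin dimv1 muln1 -size_minPoly.
have [p Ep [_ minp]] := minCpoly_irreducible (iota y).
have iotaE (q : {poly rat}) : map_poly iota (map_poly (in_alg L) q) = map_poly ratr q.
  rewrite -map_poly_comp; apply: eq_map_poly => a.
  exact: (fmorph_eq_rat (iota \o in_alg L)).
have /polyOver1P[q Eq] := minPolyOver 1 y.
have p0 : p != 0 by rewrite -(map_poly_eq0 (@ratr algC)) -Ep monic_neq0 ?minCpoly_monic.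
have q0 : q != 0.
  by rewrite -(map_poly_eq0 (in_alg L)) -Eq monic_neq0 ?monic_minPoly.
rewrite Ep Eq !size_map_poly; apply/eqP; rewrite eqn_leq; apply/andP; split.
  by apply: dvdp_leq; rewrite // -minp -iotaE fmorph_root -Eq root_minPoly.
rewrite -(size_map_poly (in_alg L) q) -(size_map_poly (in_alg L) p) -Eq.
apply: dvdp_leq; rewrite ?map_poly_eq0 //; apply: minPoly_dvdp.
  by apply/polyOver1P; exists p.
by rewrite -(fmorph_root iota) iotaE minp dvdpp.
Qed.

(* If p is the minimal polynomial of x, then p(X) p(-X) = g(X^2) where g
   vanishes at x^2, hence at all its conjugates z: a square root of z is, up to
   sign, a conjugate of x. *)
Lemma conjugate_sqr_ge0 (x z : algC) :
  totally_real_algint x -> root (minCpoly (x ^+ 2)) z -> 0 <= z.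
Proof.
case=> _ real_x z_root.
have [p Ep [_ minp]] := minCpoly_irreducible x.
have [p2 Ep2 [_ minp2]] := minCpoly_irreducible (x ^+ 2).
pose E := map_poly (@ratr algC) (even_poly p).
pose O := map_poly (@ratr algC) (odd_poly p).
have pE (w : algC) : (map_poly ratr p).[w] = E.[w ^+ 2] + O.[w ^+ 2] * w.
  rewrite -{1}(poly_even_odd p) rmorphD rmorphM /= !map_comp_poly map_polyXn map_polyX.
  by rewrite !hornerE !horner_comp !hornerE.
pose g := even_poly p ^+ 2 - 'X * odd_poly p ^+ 2.
have gE (w : algC) : (map_poly ratr g).[w ^+ 2] =
    (map_poly ratr p).[w] * (map_poly ratr p).[- w].
  rewrite !pE sqrrN /g rmorphB rmorphXn rmorphM rmorphXn /= map_polyX -/E -/O.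
  rewrite hornerD hornerN horner_exp hornerM hornerX horner_exp.
  by ring.
have px : (map_poly ratr p).[x] = 0 by apply/rootP; rewrite minp dvdpp.
have : root (map_poly ratr g) (x ^+ 2) by apply/rootP; rewrite gE px mul0r.
rewrite minp2 => /dvdpP[h gh].
have : (map_poly ratr g).[z] = 0.
  by rewrite gh rmorphM /= hornerM -Ep2 (rootP z_root) mulr0.
rewrite -[z]sqrtCK gE => /eqP; rewrite mulf_eq0 -!rootE -Ep => /orP[] /real_x.
  by move=> real_w; apply: real_exprn_even_ge0.
by rewrite rpredN => real_w; apply: real_exprn_even_ge0.
Qed.

Lemma intr_F2_eq0 (n : int) : (n%:~R == 0 :> 'F_2) = ~~ odd `|n|%N.
Proof.
rewrite [n in LHS]intEsign rmorphM rmorphXn rmorphN1 /= mulf_eq0 signr_eq0 /=.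
rewrite -[LHS]/(`|n|%N%:R == 0 :> 'F_2).
by rewrite -(dvdn_pcharf (pchar_Fp (isT : prime 2))) dvdn2.
Qed.

(** * Sums of 1 / (a - k) for a cubic *)

Section Cubic.
Variables (F : {poly int}) (a : algC).
Hypotheses (hF : map_poly intr F = minCpoly a) (szF : size (minCpoly a) = 4%N).

Lemma size_cubic : size F = 4%N.
Proof. by rewrite -szF -hF size_map_inj_poly //; apply: intr_inj. Qed.

Lemma cubicE (R : comNzRingType) (x : R) :
  (map_poly intr F).[x] = x ^+ 3 + (F`_2)%:~R * x ^+ 2 + (F`_1)%:~R * x + (F`_0)%:~R.
Proof.
have F3 : F`_3 = 1.
  have := minCpoly_monic a; rewrite -hF => /monicP.
  rewrite lead_coefE hF szF -hF coef_map /= => /eqP.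
  by rewrite (eqr_int _ _ 1) => /eqP.
rewrite (@horner_coef_wide _ 4); last first.
  by rewrite -size_cubic size_poly.
rewrite !big_ord_recr big_ord0 /= !coef_map /= F3 expr0 mulr1 expr1 add0r mul1r.
by ring.
Qed.

Lemma horner_int_cubic (R : comNzRingType) (k : nat) :
  (F.[k%:Z])%:~R = (map_poly intr F).[k%:R] :> R.
Proof. by rewrite -horner_map /=. Qed.

(** A nonzero polynomial of degree at most 2 is no multiple of the minimal polynomial, whose degree
    is 3. *)
Lemma cubic_free (x y z : rat) :
  ratr x * a ^+ 2 + ratr y * a + ratr z = 0 -> [/\ x = 0, y = 0 & z = 0].
Proof.
have [p Ep [_ minp]] := minCpoly_irreducible a.
move=> E; pose q := Poly [:: z; y; x].
have qE : q = x *: 'X^2 + y *: 'X + z%:P.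
  by rewrite /q /= !cons_poly_def -!mul_polyC; ring.
have q0 : q = 0.
  apply/eqP; apply: contraTT isT => q_neq0.
  have /dvdp_leq : p %| q.
    rewrite -minp; apply/rootP; rewrite -E qE !rmorphD /= !map_polyZ map_polyXn map_polyX.
    by rewrite map_polyC !hornerE.
  move/(_ q_neq0); rewrite -(size_map_poly (@ratr algC) p) -Ep szF leqNgt.
  by rewrite ltnS (size_Poly [:: z; y; x]).
have qi i : q`_i = 0 by rewrite q0 coef0.
by move: (qi 0%N) (qi 1%N) (qi 2%N); rewrite !coef_Poly /= => -> -> ->.
Qed.

(** As F(z) = 0, F(k) is F(k) - F(z); the quadratic factor, the divided difference of F at k and z,
    is q_k(z). *)
Lemma horner_div_sub (z : algC) (k : nat) :
    root (minCpoly a) z ->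
  (F.[k%:Z])%:~R = - (z - k%:R) * (z ^+ 2 + (k%:R + (F`_2)%:~R) * z
                     + (k%:R ^+ 2 + (F`_2)%:~R * k%:R + (F`_1)%:~R)).
Proof.
rewrite -hF => /rootP Fz; apply/eqP; rewrite horner_int_cubic -subr_eq0.
by apply/eqP; rewrite -[RHS]Fz !cubicE; ring.
Qed.

(** Otherwise a - k or q_k(a) vanishes, a nontrivial relation between 1, a and a^2. *)
Lemma horner_nat_neq0 (k : nat) : F.[k%:Z] != 0.
Proof.
apply/eqP=> Fk; have aa : root (minCpoly a) a by apply: root_minCpoly.
have := horner_div_sub k aa; rewrite Fk => /esym/eqP.
rewrite mulNr oppr_eq0 mulf_eq0 => /orP[] /eqP E.
  have := @cubic_free 0 1 (- k%:R).
  by rewrite rmorph0 rmorph1 rmorphN /= ratr_nat mul0r add0r mul1r => /(_ E)[].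
have := @cubic_free 1 (k%:R + (F`_2)%:~R) (k%:R ^+ 2 + (F`_2)%:~R * k%:R + (F`_1)%:~R).
rewrite rmorph1 !rmorphD rmorphXn rmorphM /= !ratr_nat !ratr_int mul1r.
by move/(_ E)=> [].
Qed.

Lemma minCpoly_root_neq_nat (z : algC) (k : nat) :
  root (minCpoly a) z -> z - k%:R != 0.
Proof.
move=> Fz; apply: contraNneq (horner_nat_neq0 k) => zk.
by have := horner_div_sub k Fz; rewrite zk oppr0 mul0r => /eqP; rewrite intr_eq0.
Qed.

Lemma horner_mul_invf (z : algC) (k : nat) :
    root (minCpoly a) z ->
  (F.[k%:Z])%:~R * (z - k%:R)^-1 = - (z ^+ 2 + (k%:R + (F`_2)%:~R) * z
                     + (k%:R ^+ 2 + (F`_2)%:~R * k%:R + (F`_1)%:~R)).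
Proof.
move=> Fz; rewrite (horner_div_sub k Fz) mulrC mulNr mulrN mulKf //.
exact: minCpoly_root_neq_nat.
Qed.

(** * Moments of the weights 1 / F(k) *)

Let u (k : nat) : rat := (F.[k%:Z])%:~R^-1.
Let S0 (s : seq nat) := \sum_(k <- s) u k.
Let S1 (s : seq nat) := \sum_(k <- s) k%:R * u k.
Let S2 (s : seq nat) := \sum_(k <- s) k%:R ^+ 2 * u k.

(** Each term is - q_k(z) / F(k); collecting powers of k leaves three moments, and the rational
    coefficients are the same for every root z. *)
Lemma sum_invfE (s : seq nat) (z : algC) :
    root (minCpoly a) z ->
  \sum_(k <- s) (z - k%:R)^-1 =
    - (ratr (S0 s) * z ^+ 2 + ratr (S1 s + (F`_2)%:~R * S0 s) * z
       + ratr (S2 s + (F`_2)%:~R * S1 s + (F`_1)%:~R * S0 s)).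
Proof.
move=> Fz; elim: s => [|k s IHs].
  by rewrite /S0 /S1 /S2 !big_nil !mulr0 !addr0 rmorph0 !mul0r !addr0 oppr0.
rewrite big_cons IHs /S0 /S1 /S2 !big_cons -/(S0 s) -/(S1 s) -/(S2 s).
have Fk : (F.[k%:Z])%:~R != 0 :> algC by rewrite intr_eq0 horner_nat_neq0.
have -> : (z - k%:R)^-1 = - (ratr (u k) * (z ^+ 2 + (k%:R + (F`_2)%:~R) * z
                     + (k%:R ^+ 2 + (F`_2)%:~R * k%:R + (F`_1)%:~R))).
  apply: (mulfI Fk); rewrite horner_mul_invf // fmorphV /= ratr_int.
  by rewrite mulrN mulrA divff ?mul1r.
rewrite !(rmorphD, rmorphXn, rmorphM) /= !ratr_nat !ratr_int; ring.
Qed.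

Lemma sum_invf_moments (s : seq nat) :
  \sum_(k <- s) (a - k%:R)^-1 = 1 -> [/\ S0 s = 0, S1 s = 0 & S2 s = -1].
Proof.
rewrite sum_invfE ?root_minCpoly // => E.
have [|s0] := @cubic_free (S0 s) (S1 s + (F`_2)%:~R * S0 s)
  (S2 s + (F`_2)%:~R * S1 s + (F`_1)%:~R * S0 s + 1).
  by rewrite [in ratr (_ + 1)]rmorphD rmorph1 -E addrA subrr.
rewrite s0 !mulr0 !addr0 => s1; rewrite s1 mulr0 addr0 => s2.
by split=> //; apply/eqP; rewrite -subr_eq0 opprK s2.
Qed.

Lemma sum_invf_conjugate (s : seq nat) (z : algC) :
    root (minCpoly a) z ->
  \sum_(k <- s) (a - k%:R)^-1 = 1 -> \sum_(k <- s) (z - k%:R)^-1 = 1.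
Proof.
move=> Fz /sum_invf_moments[s0 s1 s2]; rewrite sum_invfE // s0 s1 s2 !mulr0 !addr0.
by rewrite rmorph0 !mul0r !add0r rmorphN rmorph1 opprK.
Qed.

(* The moments give \sum_k 'C(k, 2) / F(k) = -1/2, which is impossible if all
   the F(k) are odd. *)
Lemma sum_invf_root_mod2 (s : seq nat) :
    \sum_(k <- s) (a - k%:R)^-1 = 1 ->
  exists x : 'F_2, root (map_poly intr F) x.
Proof.
move=> /sum_invf_moments[_ s1 s2].
case: (pickP (fun x : 'F_2 => root (map_poly intr F) x)) => [x|no_root].
  by exists x.
have oddF k : odd `|F.[k%:Z]|%N.
  by have := no_root k%:R; rewrite rootE -horner_int_cubic intr_F2_eq0 => /negbFE.
(* The product of the |F(k)| serves as an odd common denominator N. *)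
have half r : exists2 N : nat, odd N &
    exists m : int, N%:R * \sum_(k <- r) 'C(k, 2)%:R * u k = m%:~R.
  elim: r => [|k r [N oddN [m Em]]].
    by exists 1%N => //; exists 0; rewrite big_nil mulr0.
  exists (`|F.[k%:Z]| * N)%N; first by rewrite oddM oddF.
  exists (N%:Z * 'C(k, 2)%:Z * sgz F.[k%:Z] + `|F.[k%:Z]|%N%:Z * m).
  rewrite big_cons rmorphD !rmorphM /= -Em.
  have -> : (sgz F.[k%:Z])%:~R = `|F.[k%:Z]|%N%:R * u k.
    have Fk : (F.[k%:Z])%:~R != 0 :> rat by rewrite intr_eq0 horner_nat_neq0.
    by apply: (canRL (mulfK Fk)); rewrite -rmorphM /= -abszEsg.
  by ring.
have [N oddN [m]] := half s.
have -> : \sum_(k <- s) 'C(k, 2)%:R * u k = - 2^-1.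
  have C2 k : 'C(k, 2)%:R = 2^-1 * (k%:R ^+ 2 - k%:R) :> rat.
    have := mul_bin_left k 1; rewrite bin1 => C2.
    have {C2} : (k ^ 2 = 2 * 'C(k, 2) + k)%N by rewrite C2; case: (k) => // n; nia.
    by move/(congr1 (fun n => n%:R : rat)); rewrite natrD natrM natrX => ->; field.
  under eq_bigr => k _ do rewrite C2 -mulrA mulrBl.
  by rewrite -big_distrr sumrB /= -/(S2 s) -/(S1 s) s1 s2; ring.
move=> Em; have : N%:Z = - 2 * m.
  by apply: (@intr_inj rat); rewrite rmorphM /= -Em; field.
lia.
Qed.


(* Otherwise x |-> \sum_k 1 / (x - k) would decrease strictly from z to w. *)
Lemma nat_between_conjugates (s : seq nat) (z w : algC) :
    \sum_(k <- s) (a - k%:R)^-1 = 1 ->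
    root (minCpoly a) z -> root (minCpoly a) w -> z < w -> w \is Num.real ->
  exists k : nat, z < k%:R < w.
Proof.
move=> sum1 Fz Fw zw real_w.
have real_z : z \is Num.real by rewrite (ler_real (ltW zw)).
have /hasP[k _ k_zw] : has (fun k => z < k%:R < w) s; last by exists k.
apply: contraT => /hasPn no_k.
have s_neq0 : s != [::].
  by apply: contra_eq_neq sum1 => ->; rewrite big_nil eq_sym oner_eq0.
have sumz := sum_invf_conjugate Fz sum1.
suff : \sum_(k <- s) (w - k%:R)^-1 < \sum_(k <- s) (z - k%:R)^-1.
  by rewrite sumz (sum_invf_conjugate Fw sum1) ltxx.
have lt_s k : k \in s -> (w - k%:R)^-1 < (z - k%:R)^-1.
  move=> /no_k; have zk := minCpoly_root_neq_nat k Fz.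
  have wk := minCpoly_root_neq_nat k Fw.
  have [lt_zk|le_kz] := real_ltP real_z (realn _ k) => /=.
    move=> /negP lt_kw; have {lt_kw} lt_wk : w < k%:R.
      have [//|le_kw] := real_ltP real_w (realn _ k).
      by case: lt_kw; rewrite lt_neqAle le_kw -subr_eq0 -opprB oppr_eq0 wk.
    by rewrite ltf_nV2 ?ltrD2r // negrE subr_lt0.
  move=> _; have lt_kz : k%:R < z by rewrite lt_neqAle le_kz eq_sym -subr_eq0 zk.
  by rewrite ltf_pV2 ?ltrD2r // posrE subr_gt0 // (lt_trans lt_kz).
case: (s) s_neq0 lt_s => // k s' _ lt_s; rewrite !big_cons.
apply: ltr_leD; first by rewrite lt_s ?mem_head.
rewrite big_seq [leRHS]big_seq.
by apply: ler_sum => i i_s'; rewrite ltW // lt_s // inE i_s' orbT.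
Qed.

(** * Nonnegative integral combinations of the 1 / (a - k) *)

Definition sum_invf (z : algC) : Prop :=
  exists s : seq nat, z = \sum_(k <- s) (a - k%:R)^-1.

Lemma sum_invfD (x y : algC) : sum_invf x -> sum_invf y -> sum_invf (x + y).
Proof. by case=> [s ->] [t ->]; exists (s ++ t); rewrite big_cat. Qed.

Lemma sum_invfMn (x : algC) (n : nat) : sum_invf x -> sum_invf (x *+ n).
Proof.
move=> Sx; elim: n => [|n IHn]; first by exists [::]; rewrite big_nil.
by rewrite mulrS; apply: sum_invfD.
Qed.

Lemma sum_invf1 (k : nat) : sum_invf (a - k%:R)^-1.
Proof. by exists [:: k]; rewrite big_seq1. Qed.

Lemma sum_invf_pos (n : int) (k : nat) :
  0 < n -> sum_invf (n%:~R * (a - k%:R)^-1).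
Proof.
case: n => // n _; rewrite -[_%:~R]/(n%:R) mulr_natl.
exact/sum_invfMn/sum_invf1.
Qed.

(** From n t + x = 0 with n > 0 follows - t = (n - 1) t + x. *)
Lemma sum_invfN (n : int) (k : nat) (x : algC) :
    0 < n -> sum_invf x -> n%:~R * (a - k%:R)^-1 + x = 0 ->
  sum_invf (- (a - k%:R)^-1).
Proof.
case: n => // -[//|n] _ Sx; rewrite -[_%:~R]/(n.+1%:R) mulr_natl mulrS.
move=> E; have -> : - (a - k%:R)^-1 = (a - k%:R)^-1 *+ n + x.
  by apply/eqP; rewrite eq_sym -subr_eq0 opprK addrC addrA E.
exact: sum_invfD (sum_invfMn _ (sum_invf1 k)) Sx.
Qed.

(** F(x) / (a - x) is quadratic in x, so its third divided difference at the four points is zero;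
    the alternating signs of F make every coefficient of this relation positive. *)
Lemma alternating_invfN (i j k l : nat) :
    (i < j < k)%N -> (k < l)%N ->
    F.[i%:Z] < 0 -> 0 < F.[j%:Z] -> F.[k%:Z] < 0 -> 0 < F.[l%:Z] ->
  [/\ sum_invf (- (a - i%:R)^-1), sum_invf (- (a - j%:R)^-1),
      sum_invf (- (a - k%:R)^-1) & sum_invf (- (a - l%:R)^-1)].
Proof.
case/andP=> ij jk kl Fi Fj Fk Fl.
(* With denominators cleared, each point is weighted, up to alternating signs, by the Vandermonde
   product [D] of the other three. *)
pose D (x y z : nat) : int := (y%:Z - x%:Z) * (z%:Z - x%:Z) * (z%:Z - y%:Z).
have D_gt0 x y z : (x < y)%N -> (y < z)%N -> 0 < D x y z.
  by move=> xy yz; rewrite /D !mulr_gt0 ?subr_gt0 ?ltz_nat // (ltn_trans xy).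
pose ni := D j k l * - F.[i%:Z]; pose nj := D i k l * F.[j%:Z].
pose nk := D i j l * - F.[k%:Z]; pose nl := D i j k * F.[l%:Z].
have ik := ltn_trans ij jk; have jl := ltn_trans jk kl.
have ni0 : 0 < ni by rewrite mulr_gt0 ?oppr_gt0 ?D_gt0.
have nj0 : 0 < nj by rewrite mulr_gt0 ?D_gt0.
have nk0 : 0 < nk by rewrite mulr_gt0 ?oppr_gt0 ?D_gt0.
have nl0 : 0 < nl by rewrite mulr_gt0 ?D_gt0.
have rel : ni%:~R * (a - i%:R)^-1 + nj%:~R * (a - j%:R)^-1
           + nk%:~R * (a - k%:R)^-1 + nl%:~R * (a - l%:R)^-1 = 0.
  pose d (x y z : nat) : algC := (y%:R - x%:R) * (z%:R - x%:R) * (z%:R - y%:R).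
  pose f (x : nat) : algC := (F.[x%:Z])%:~R * (a - x%:R)^-1.
  transitivity (- d j k l * f i + d i k l * f j - d i j l * f k + d i j k * f l).
    by rewrite /ni /nj /nk /nl /D /d /f !rmorphM !rmorphN !rmorphB /=; ring.
  by rewrite /f !horner_mul_invf ?root_minCpoly // /d; ring.
have [Si Sj Sk Sl] := And4 (sum_invf_pos i ni0) (sum_invf_pos j nj0)
  (sum_invf_pos k nk0) (sum_invf_pos l nl0).
split.
- apply: (sum_invfN ni0 (sum_invfD Sj (sum_invfD Sk Sl))).
  by rewrite -rel; ring.
- apply: (sum_invfN nj0 (sum_invfD Si (sum_invfD Sk Sl))).
  by rewrite -rel; ring.
- apply: (sum_invfN nk0 (sum_invfD Si (sum_invfD Sj Sl))).
  by rewrite -rel; ring.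
- apply: (sum_invfN nl0 (sum_invfD Si (sum_invfD Sj Sk))).
  by rewrite -rel; ring.
Qed.

Lemma sum_invf_int (n : int) (k : nat) :
  sum_invf (- (a - k%:R)^-1) -> sum_invf (n%:~R * (a - k%:R)^-1).
Proof.
move=> SN; case: n => n.
  by rewrite -[_%:~R]/(n%:R) mulr_natl; apply/sum_invfMn/sum_invf1.
by rewrite NegzE mulrNz mulNr -mulrN -[_%:~R]/(n.+1%:R) mulr_natl; apply: sum_invfMn.
Qed.

(* The second difference of k |-> F(k) / (a - k) is -2. *)
Lemma sum_invf_one (x : 'F_2) :
    (forall k : nat, sum_invf (- (a - k%:R)^-1)) ->
  root (map_poly intr F) x -> sum_invf 1.
Proof.
move=> SN; rewrite -[x]natr_Zp; set k : nat := x.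
have evenF n : root (map_poly intr F) (n%:R : 'F_2) -> exists m, F.[n%:Z] = m * 2.
  rewrite rootE -horner_int_cubic intr_F2_eq0 => Fn.
  by apply/dvdzP; rewrite dvdzE dvdn2.
move=> Fk; have [m0 Em0] := evenF k Fk.
have [m2 Em2] : exists m, F.[(k + 2)%N%:Z] = m * 2.
  by apply: evenF; rewrite natrD (pchar_Zp (isT : (1 < 2)%N)) addr0.
have f0 := horner_mul_invf k (root_minCpoly a).
have f1 := horner_mul_invf (k + 1) (root_minCpoly a).
have f2 := horner_mul_invf (k + 2) (root_minCpoly a).
(* This is the second difference divided by -2; evenness at k and k + 2 keeps the coefficients
   integral. *)
have -> : 1 = - m0%:~R * (a - k%:R)^-1 + ((F.[(k + 1)%N%:Z])%:~R * (a - (k + 1)%:R)^-1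
                 + - m2%:~R * (a - (k + 2)%:R)^-1).
  have two : 2 != 0 :> algC by rewrite pnatr_eq0.
  apply: (mulfI two); rewrite mulr1.
  transitivity (- ((F.[k%:Z])%:~R * (a - k%:R)^-1)
    + 2 * ((F.[(k + 1)%N%:Z])%:~R * (a - (k + 1)%:R)^-1)
    - (F.[(k + 2)%N%:Z])%:~R * (a - (k + 2)%:R)^-1).
    by rewrite f0 f1 f2 !natrD; ring.
  by rewrite Em0 Em2 !rmorphM /=; ring.
by rewrite -!rmorphN; do 2?[apply: sum_invfD]; apply: sum_invf_int.
Qed.

(** * Cubics with three positive roots *)

Section Roots.
Variables A B C : algC.
Hypotheses (defF : minCpoly a = \prod_(z <- [:: A; B; C]) ('X - z%:P)).
Hypotheses (A0 : 0 < A) (AB : A < B) (BC : B < C).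

Lemma root_cubic (z : algC) : root (minCpoly a) z = (z \in [:: A; B; C]).
Proof. by rewrite defF root_prod_XsubC. Qed.

Lemma horner_cubic_factor (k : nat) :
  (F.[k%:Z])%:~R = (k%:R - A) * (k%:R - B) * (k%:R - C).
Proof.
by rewrite horner_int_cubic hF defF !big_cons big_nil mulr1 !hornerM !hornerXsubC mulrA.
Qed.

(** No root is a natural number, so k lies in one of the four open intervals; the other three are
    represented among [j1], [j2], [j3] and a natural number beyond [C], and [alternating_invfN]
    applies. *)
Lemma invfN_cubic (j1 j2 j3 : nat) :
    j1%:R < A -> A < j2%:R < B -> B < j3%:R < C ->
  forall k : nat, sum_invf (- (a - k%:R)^-1).
Proof.
move=> j1A /andP[Aj2 j2B] /andP[Bj3 j3C] k.
have B0 := lt_trans A0 AB; have C0 := lt_trans B0 BC.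
have AC := lt_trans AB BC.
have lt_C : C < (Num.bound C)%:R by apply: archi_boundP; apply: ltW.
have neq z : z \in [:: A; B; C] -> z != k%:R.
  by rewrite -root_cubic -subr_eq0 => /(minCpoly_root_neq_nat k).
have lt_nat (i j : nat) (z : algC) : i%:R < z -> z < j%:R -> (i < j)%N.
  by move=> iz zj; rewrite -(ltr_nat algC) (lt_trans iz).
have neg1 i : i%:R < A -> F.[i%:Z] < 0.
  move=> iA; rewrite -(ltrz0 algC) horner_cubic_factor.
  by rewrite nmulr_llt0 ?nmulr_rgt0 ?subr_lt0 // ?(lt_trans iA) // (lt_trans AB).
have pos2 i : A < i%:R < B -> 0 < F.[i%:Z].
  case/andP=> Ai iB; rewrite -(ltr0z algC) horner_cubic_factor.
  by rewrite nmulr_lgt0 ?pmulr_rlt0 ?subr_lt0 ?subr_gt0 // (lt_trans iB).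
have neg3 i : B < i%:R < C -> F.[i%:Z] < 0.
  case/andP=> Bi iC; rewrite -(ltrz0 algC) horner_cubic_factor.
  by rewrite pmulr_rlt0 ?mulr_gt0 ?subr_lt0 ?subr_gt0 // (lt_trans AB).
have pos4 i : C < i%:R -> 0 < F.[i%:Z].
  move=> Ci; rewrite -(ltr0z algC) horner_cubic_factor.
  by rewrite !mulr_gt0 ?subr_gt0 // (lt_trans _ Ci).
pose l := Num.bound C.
have alt i1 i2 i3 i4 : i1%:R < A -> A < i2%:R < B -> B < i3%:R < C -> C < i4%:R ->
    [/\ sum_invf (- (a - i1%:R)^-1), sum_invf (- (a - i2%:R)^-1),
      sum_invf (- (a - i3%:R)^-1) & sum_invf (- (a - i4%:R)^-1)].
  move=> i1A i2AB i3BC Ci4.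
  apply: alternating_invfN (neg1 _ i1A) (pos2 _ i2AB) (neg3 _ i3BC) (pos4 _ Ci4).
    case/andP: i2AB => Ai2 i2B; case/andP: i3BC => Bi3 _.
    by rewrite (lt_nat _ _ _ i1A Ai2) (lt_nat _ _ _ i2B Bi3).
  by case/andP: i3BC => _ i3C; apply: lt_nat i3C Ci4.
have lt_or z : 0 < z -> z \in [:: A; B; C] -> k%:R < z \/ z < k%:R.
  move=> z0 /neq zk; have [|] := real_ltP (realn algC k) (gtr0_real z0); first by left.
  by rewrite le_eqVlt (negPf zk); right.
have [kA|Ak] := lt_or A A0 (mem_head _ _).
  by have [] := alt k j2 j3 l kA; rewrite ?Aj2 ?Bj3.
have [kB|Bk] : k%:R < B \/ B < k%:R by apply: lt_or; rewrite // !inE eqxx orbT.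
  by have [] := alt j1 k j3 l j1A; rewrite ?Ak ?Bj3.
have [kC|Ck] : k%:R < C \/ C < k%:R by apply: lt_or; rewrite // !inE eqxx !orbT.
  by have [] := alt j1 j2 k l j1A; rewrite ?Aj2 ?Bk.
by have [] := alt j1 j2 j3 k j1A; rewrite ?Aj2 ?Bj3.
Qed.

Lemma pos_roots_cubic : pos_roots a [tuple sqrtC A; sqrtC B; sqrtC C].
Proof.
have B0 := lt_trans A0 AB; have C0 := lt_trans B0 BC.
split; first by rewrite /= !ltr_sqrtC ?AB ?BC ?qualifE /= ?ltW.
move=> z; have -> : root (minCpoly a \Po 'X^2) z = (z ^+ 2 \in [:: A; B; C]).
  by rewrite -root_cubic !rootE horner_comp !hornerE.
rewrite !inE; split=> [/or3P[]/eqP->|[z0]].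
- by rewrite sqrtC_gt0 A0 sqrtCK eqxx.
- by rewrite sqrtC_gt0 B0 sqrtCK eqxx orbT.
- by rewrite sqrtC_gt0 C0 sqrtCK eqxx !orbT.
by case/or3P=> /eqP Ez; rewrite -(sqrCK (ltW z0)) Ez eqxx ?orbT.
Qed.

(** Since A > 0, the number 0 can be the least element of a left-interlacing set. *)
Lemma interlacing_cubic (k2 k3 : nat) :
    A < k2%:R < B -> B < k3%:R < C ->
  interlacing_set a [tuple 0%N; k2; k3].
Proof.
case/andP=> Ak2 k2B /andP[Bk3 k3C].
exists [tuple sqrtC A; sqrtC B; sqrtC C]; first exact: pos_roots_cubic.
left; split.
- rewrite /= -!(ltr_nat algC) (lt_trans A0 Ak2) (lt_trans k2B Bk3) //.
- by case=> -[|[|[|?]]] //= ?; rewrite !(tnth_nth 0) /= sqrtCK.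
case=> -[|[|[|?]]] //= ? [[|[|[|?]]] //= ?] //= _;
  by rewrite !(tnth_nth 0) /= sqrtCK.
Qed.

End Roots.

End Cubic.

(** * Conjugates, interlacing sets and the equivalence *)

Lemma minCpoly_sqr_roots (lambda : algC) :
    totally_real_algint lambda -> size (minCpoly (lambda ^+ 2)) = 4%N ->
    ~~ root (minCpoly (lambda ^+ 2)) 0 ->
  exists A B C : algC, [/\ 0 < A, A < B, B < C
    & minCpoly (lambda ^+ 2) = \prod_(z <- [:: A; B; C]) ('X - z%:P)].
Proof.
move=> real_l sz root0; set p := minCpoly _ in sz root0 *.
have [r] := closed_field_poly_normal p.
rewrite (monicP (minCpoly_monic _)) scale1r => Ep.
have pos_r z : z \in r -> 0 < z.
  rewrite -root_prod_XsubC -Ep => pz; rewrite lt_neqAle (conjugate_sqr_ge0 real_l pz).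
  by rewrite andbT; apply: contraNneq root0 => ->.
(* The order of [algC] is only partial, but total on positive numbers, so the conjugates can be
   sorted. *)
have tot : {in r &, total (<=%R : rel algC)}.
  by move=> x y /pos_r x0 /pos_r y0; apply: real_leVge; apply: gtr0_real.
have Us : uniq (sort <=%R r) by rewrite sort_uniq (uniq_roots_minCpoly Ep).
have Ss : sorted <%R (sort <=%R r).
  by rewrite lt_sorted_uniq_le Us (sort_sorted_in tot) //; apply/allP.
have Es : perm_eq (sort <=%R r) r by rewrite perm_sort.
have sz_s : size (sort <=%R r) = 3%N.
  by rewrite size_sort; move: sz; rewrite Ep size_prod_XsubC => -[].
move: (perm_mem Es) Ss sz_s (perm_big _ Es : _ = \prod_(z <- r) ('X - z%:P)).
case: (sort _ r) => [|A [|B [|C []]]] //= mem_s /and3P[AB BC _] _ Er.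
exists A, B, C; split=> //; last by rewrite Er.
by apply: pos_r; rewrite -mem_s mem_head.
Qed.

(** The squares of the three positive roots of F(x^2) are distinct roots of F, hence all of them. *)
Lemma interlacing_set3 (a : algC) (k : 3.-tuple nat) :
    size (minCpoly a) = 4%N -> interlacing_set a k ->
  exists A B C (j2 j3 : nat), [/\ 0 < A, A < j2%:R < B, B < j3%:R < C
    & minCpoly a = \prod_(z <- [:: A; B; C]) ('X - z%:P)].
Proof.
move=> sz [l [sort_l root_l] int_l].
case: l sort_l root_l int_l => -[|A [|B [|C []]]] //= sz_l sort_l root_l int_l.
have [A0 Aroot] : 0 < A /\ root (minCpoly a \Po 'X^2) A.
  by apply/root_l; rewrite !inE eqxx.
have [B0 Broot] : 0 < B /\ root (minCpoly a \Po 'X^2) B.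
  by apply/root_l; rewrite !inE eqxx orbT.
have [C0 Croot] : 0 < C /\ root (minCpoly a \Po 'X^2) C.
  by apply/root_l; rewrite !inE eqxx !orbT.
case/and3P: sort_l => AB BC _.
have AB2 : A ^+ 2 < B ^+ 2 by rewrite ltr_pXn2r // ?nnegrE ltW.
have BC2 : B ^+ 2 < C ^+ 2 by rewrite ltr_pXn2r // ?nnegrE ltW.
have defp : minCpoly a = \prod_(z <- [:: A ^+ 2; B ^+ 2; C ^+ 2]) ('X - z%:P).
  have rootX z : root (minCpoly a \Po 'X^2) z = root (minCpoly a) (z ^+ 2).
    by rewrite !rootE horner_comp !hornerE.
  rewrite (@all_roots_prod_XsubC _ (minCpoly a) [:: A ^+ 2; B ^+ 2; C ^+ 2]).
  - by rewrite (monicP (minCpoly_monic _)) scale1r.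
  - by rewrite sz.
  - by rewrite /= -!rootX Aroot Broot Croot.
  by rewrite uniq_rootsE /= !inE !negb_or !lt_eqF // (lt_trans AB2).
exists (A ^+ 2), (B ^+ 2), (C ^+ 2).
(* The two middle gaps contain the last two elements of a left-interlacing set, or the first two of
   a right-interlacing one. *)
case: int_l => [[_ lt_l gt_l]|[_ gt_l lt_l]].
  exists (tnth k 1), (tnth k 2); split; rewrite ?exprn_gt0 //.
    by rewrite (gt_l 0 1 erefl) (lt_l 1).
  by rewrite (gt_l 1 2 erefl) (lt_l 2).
exists (tnth k 0), (tnth k 1); split; rewrite ?exprn_gt0 //.
  by rewrite (gt_l 0) (lt_l 0 1 erefl).
by rewrite (gt_l 1) (lt_l 1 2 erefl).
Qed.

Theorem theorem2 (lambda : algC) (F : {poly int})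
    (hlambda : totally_real_algint lambda)
    (hdeg : degreeQ (lambda ^+ 2) 3)
    (hF : map_poly intr F = minCpoly (lambda ^+ 2)) :
  arboreal 2 lambda <->
  (exists k : 3.-tuple nat, interlacing_set (lambda ^+ 2) k) /\
  (exists a : 'F_2, root (map_poly intr F) a).
Proof.
have sz := size_minCpoly_degreeQ hdeg.
have sqr_neq_nat k : lambda ^+ 2 != k%:R.
  by rewrite -subr_eq0 (minCpoly_root_neq_nat hF sz) ?root_minCpoly.
split=> [[_ /(tree_eigenvalue2P sqr_neq_nat)[s sum1]]|[[k int_k] [x Fx]]].
  split; last exact: sum_invf_root_mod2 hF sz s sum1.
  have root0 : ~~ root (minCpoly (lambda ^+ 2)) 0.
    by apply/negP=> /(minCpoly_root_neq_nat hF sz 0); rewrite subrr eqxx.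
  have [A [B [C [A0 AB BC defp]]]] := minCpoly_sqr_roots hlambda sz root0.
  have real_gt0 z : A < z -> z \is Num.real by move/(lt_trans A0)/gtr0_real.
  have [||||k2 k2AB] := nat_between_conjugates hF sz sum1 (z := A) (w := B).
  - by rewrite (root_cubic defp) mem_head.
  - by rewrite (root_cubic defp) !inE eqxx orbT.
  - by [].
  - exact: real_gt0.
  have [||||k3 k3BC] := nat_between_conjugates hF sz sum1 (z := B) (w := C).
  - by rewrite (root_cubic defp) !inE eqxx orbT.
  - by rewrite (root_cubic defp) !inE eqxx !orbT.
  - by [].
  - exact/real_gt0/(lt_trans AB).
  by exists [tuple 0%N; k2; k3]; apply: interlacing_cubic defp A0 AB BC _ _ k2AB k3BC.
split=> //; apply/(tree_eigenvalue2P sqr_neq_nat).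
have [A [B [C [j2 [j3 [A0 j2AB j3BC defp]]]]]] := interlacing_set3 sz int_k.
have AB : A < B by case/andP: j2AB; apply: lt_trans.
have BC : B < C by case/andP: j3BC; apply: lt_trans.
have [s sum1] : sum_invf (lambda ^+ 2) 1; last by exists s.
apply: (sum_invf_one hF sz _ Fx).
(* The interval below the least conjugate contains 0. *)
exact: (invfN_cubic hF sz defp A0 AB BC (j1 := 0%N) A0 j2AB j3BC).
Qed.
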